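(* Let $\mathcal{A} = A_1, A_2, \dots$ be a lineage of deterministic autopoietic automata reading a single input stream (each $A_{i+1}$ being the new offspring of $A_i$ and continuing to read the input stream from the position reached by $A_i$). Then there is a deterministic interactive Turing machine that simulates $\mathcal{A}$: on every input stream it produces the same output stream as the lineage, where the symbols read and written by the automata $A_i$ are represented by fixed encodings over the Turing machine's fixed input and output alphabets.
   Context: A (deterministic) autopoietic automaton $A$ is a finite automaton with state set $Q$, a start state $q_0 \in Q\setminus R$, a subset $R\subseteq Q$ of reproducing-mode states (states in $Q\setminus R$ are transducer-mode states), a special state $q_1\in R$, and a transition partial function $\delta$ (a partial function of (observed symbol, current state), giving a new state, a symbol to write, and a direction). Symbols come from a potentially infinite alphabet $\sigma_1,\sigma_2,\dots$, with $\sigma_i$ encoded in unary by $i$. The automaton has a finite read-only input tape which always contains the code of $A$: a sequence, in arbitrary order, of 5-tuples (observed symbol, current state, new state, new symbol, direction), one per transition of $\delta$, written in binary/unary encoding. In reproducing mode (states in $R$) the automaton works like a Turing machine head on this read-only input tape (moving left/right) and writes symbols onto a one-way output tape. In transducer mode (states in $Q\setminus R$) it does not touch the tapes, but reads one symbol at a time from an input buffer connected to an infinite input stream and writes one symbol at a time into an output buffer, producing an output stream. When reproducing mode ends by entering $q_1$, $A$ splits into two automata: the old $A$ with the same input tape and an empty output tape, and the offspring $A'$ whose input tape is the previous output tape and whose output tape is empty; both start in $q_0$ with heads at the left end of their tapes. If the offspring's input tape is not a proper encoding of a transition function, the offspring stops. The offspring relation defines a tree of autopoietic automata; a lineage is a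 path $A_1, A_2, \dots$ in this tree starting from a single automaton $A_1$. An interactive Turing machine is a Turing machine that reads one symbol at a time from an input buffer connected to an input stream and writes one symbol at a time to an output buffer, creating an output stream. *)

(* Defs.v *)
From mathcomp Require Import all_boot.
Set Implicit Arguments. Unset Strict Implicit. Unset Printing Implicit Defensive.

(* Symbols: the symbol sigma_i (i >= 1) is represented by the natural i.     *)
(* The value 0 is not a symbol: it is the blank read beyond the ends of the  *)
(* read-only input tape, and writing 0 means "write nothing".                *)
(* States are naturals: q0 = 0, q1 = 1, and R (reproducing-mode states) is   *)
(* the set of odd states (so q0 \notin R and q1 \in R).                      *)
(* Directions: 0 = left, 1 = right.                                          *)

(* (observed symbol, current state, new state, new symbol, direction) *)
Definition transition := (nat * nat * nat * nat * nat)%type.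

Definition q0 : nat := 0.
Definition q1 : nat := 1.
Definition in_R (q : nat) : bool := odd q.

Definition enc_num (n : nat) : seq nat := rcons (nseq n 1) 2.

Definition enc_trans (t : transition) : seq nat :=
  let: (a, q, q', b, d) := t in
  enc_num a ++ enc_num q ++ enc_num q' ++ enc_num b ++ enc_num d.

Definition encode (c : seq transition) : seq nat := flatten (map enc_trans c).

Fixpoint parse_nums (s : seq nat) (acc : nat) : option (seq nat) :=
  match s with
  | [::] => if acc == 0 then Some [::] else None
  | 1 :: t => parse_nums t acc.+1
  | 2 :: t => omap (cons acc) (parse_nums t 0)
  | _ => None
  end.

Fixpoint group5 (l : seq nat) : option (seq transition) :=
  match l with
  | [::] => Some [::]
  | a :: q :: q' :: b :: d :: t => omap (cons (a, q, q', b, d)) (group5 t)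
  | _ => None
  end.

Definition tkey (t : transition) : nat * nat := let: (a, q, _, _, _) := t in (a, q).

Definition proper (c : seq transition) : bool :=
  all (fun t : transition => let: (_, _, _, _, d) := t in d <= 1) c
  && uniq (map tkey c).

Definition decode (s : seq nat) : option (seq transition) :=
  match obind group5 (parse_nums s 0) with
  | Some c => if proper c then Some c else None
  | None => None
  end.

Definition is_code (s : seq nat) : bool := decode s != None.

Definition lookup (c : seq transition) (a q : nat) : option (nat * nat * nat) :=
  match [seq t <- c | tkey t == (a, q)] with
  | (_, _, q', b, d) :: _ => Some (q', b, d)
  | [::] => None
  end.

(* Configuration of the lineage: the currently active automaton A_i is given
   by its input tape [tape] (its code) and its decoded transition function
   [delta]; then its current state, input-tape head position, output-tape
   content, the position in the input stream, and the output stream produced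
   so far by the whole lineage. *)
Record lconf := LConf {
  l_tape : seq nat; l_delta : seq transition; l_state : nat; l_head : nat;
  l_otape : seq nat; l_inpos : nat; l_out : seq nat }.

Definition emit (s : seq nat) (b : nat) : seq nat := if b == 0 then s else rcons s b.

(* After the transition, if q1 is entered the automaton splits and the lineage
   continues with the new offspring (input tape = old output tape, state q0,
   head at left end, empty output tape), which continues reading the stream
   from the current position; if the offspring's tape is not a proper code,
   the offspring (hence the lineage) stops. *)
Definition continue_or_split (c : lconf) (q' p' : nat) (o' : seq nat)
    (k' : nat) (out' : seq nat) : option lconf :=
  if q' == q1 then
    match decode o' with
    | Some d' => Some (LConf o' d' q0 0 [::] k' out')
    | None => None
    end
  else Some (LConf (l_tape c) (l_delta c) q' p' o' k' out').

Definition lstep (x : nat -> nat) (c : lconf) : option lconf :=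
  let q := l_state c in
  if in_R q then
    let a := nth 0 (l_tape c) (l_head c) in
    match lookup (l_delta c) a q with
    | None => None
    | Some (q', b, d) =>
        continue_or_split c q' (if d == 0 then (l_head c).-1 else (l_head c).+1)
          (emit (l_otape c) b) (l_inpos c) (l_out c)
    end
  else
    let a := x (l_inpos c) in
    match lookup (l_delta c) a q with
    | None => None
    | Some (q', b, d) =>
        continue_or_split c q' (l_head c) (l_otape c) (l_inpos c).+1
          (emit (l_out c) b)
    end.

Fixpoint iter_step {C : Type} (step : C -> option C) (n : nat) (c : C) : C :=
  match n with
  | 0 => c
  | n'.+1 => match step c with None => c | Some c' => iter_step step n' c' end
  end.

Definition lineage_init (t1 : seq nat) : lconf :=
  LConf t1 (odflt [::] (decode t1)) q0 0 [::] 0 [::].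

Definition lineage_out (t1 : seq nat) (x : nat -> nat) (n : nat) : seq nat :=
  l_out (iter_step (lstep x) n (lineage_init t1)).

Inductive move := MLeft | MRight | MStay.

Record itm := ITM {
  iQ : finType; iG : finType; iblank : iG; istart : iQ;
  ireads : iQ -> iG -> bool;
  idelta : iQ -> iG -> option bool -> option (iQ * iG * move * option bool) }.

Record iconf (M : itm) := IConf {
  i_state : iQ M; i_tape : nat -> iG M; i_head : nat; i_inpos : nat;
  i_out : seq bool }.

Definition istep (M : itm) (s : nat -> bool) (c : iconf M) : option (iconf M) :=
  let g := i_tape c (i_head c) in
  let r := ireads (i_state c) g in
  let inp := if r then Some (s (i_inpos c)) else None in
  match idelta (i_state c) g inp with
  | None => None
  | Some (q', g', m, o) =>
      Some (IConf q'
        (fun p => if p == i_head c then g' else i_tape c p)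
        (match m with MLeft => (i_head c).-1 | MRight => (i_head c).+1 | MStay => i_head c end)
        (if r then (i_inpos c).+1 else i_inpos c)
        (if o is Some b then rcons (i_out c) b else i_out c))
  end.

Definition itm_init (M : itm) : iconf M := IConf (istart M) (fun _ => iblank M) 0 0 [::].

Definition itm_out (M : itm) (s : nat -> bool) (n : nat) : seq bool :=
  i_out (iter_step (istep s) n (itm_init M)).

Definition enc_sym (a : nat) : seq bool := rcons (nseq a true) false.

Definition enc_out (s : seq nat) : seq bool := flatten (map enc_sym s).

Fixpoint enc_at (fuel : nat) (x : nat -> nat) (k p : nat) : bool :=
  match fuel with
  | 0 => false
  | f.+1 => if p < x k then true
            else if p == x k then false
            else enc_at f x k.+1 (p - (x k).+1)
  end.

(* the encoded input stream: enc_sym (x 0) ++ enc_sym (x 1) ++ ... *)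
Definition enc_stream (x : nat -> nat) (p : nat) : bool := enc_at p.+1 x 0 p.

(* two output processes (outputs after n steps, growing) produce the same
   (finite or infinite) output stream *)
Definition same_stream (f g : nat -> seq bool) : Prop :=
  (forall n, exists m, prefix (f n) (g m)) /\ (forall m, exists n, prefix (g m) (f n)).

(* Main.v *)
Require Import Defs.
From mathcomp Require Import all_boot.
From Stdlib Require Import FunctionalExtensionality.
Set Implicit Arguments. Unset Strict Implicit. Unset Printing Implicit Defensive.

(* The current automaton is determined by its input tape, so a universal
   machine only has to store that tape, the head position, the state and the
   output tape.  The machine is written in a loop language over finitely many
   stacks of bits, all loops of which run over the contents of a stack and so
   terminate; a program therefore denotes a function on stores, and one round
   of the interpreter maps an encoding of a configuration to an encoding of its
   successor.  The stacks are the tracks of a single tape, and the language is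
   compiled to single-tape programs.  A lineage that stops is simulated by a
   machine that runs silently forever.  Whether the offspring is proper has to
   be decided before the last symbol is output, since a lineage that stops at
   the split does not perform the transition. *)

(** * Structured one-tape programs *)

Lemma iter_step_add C (step : C -> option C) m n c :
  iter_step step (m + n) c = iter_step step n (iter_step step m c).
Proof.
elim: m c => [|m IH] c //=; case E: (step c) => [c'|]; first exact: IH.
by case: n {IH} => //= n; rewrite E.
Qed.

Lemma iter_stepSr C (step : C -> option C) n c :
  iter_step step n.+1 c = odflt (iter_step step n c) (step (iter_step step n c)).
Proof. by rewrite -addn1 iter_step_add /=; case: (step _). Qed.

Section Raw.
Variable G : finType.

(** [WhileRead] takes its guard from the input stream and consumes one bit per test, the failing one
    included; this is the way a symbol in unary is read. *)
Inductive raw :=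
| Act of (G -> G * move * option bool)
| Sequ of raw & raw
| If of pred G & raw & raw
| While of pred G & raw
| WhileRead of raw.

(** Positions become the states of the machine, hence a finite type. The extra [None] of the
    branching and looping constructs is the position at which their test is made. *)
Fixpoint pos (r : raw) : finType :=
  match r with
  | Act _ => unit
  | Sequ a b => (pos a + pos b)%type
  | If _ a b => option (pos a + pos b)%type
  | While _ a | WhileRead a => option (pos a)
  end.

Fixpoint start (r : raw) : pos r :=
  match r with
  | Act _ => tt
  | Sequ a b => inl (start a)
  | If _ a b => None
  | While _ a => None
  | WhileRead a => None
  end.

Fixpoint reads (r : raw) : pos r -> bool :=
  match r with
  | Act _ => fun _ => false
  | Sequ a b => fun p => match p with inl p => reads p | inr p => reads p end
  | If _ a b => fun p =>
      match p with
      | Some (inl p) => reads p | Some (inr p) => reads p | None => false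
      end
  | While _ a => fun p => if p is Some p then reads p else false
  | WhileRead a => fun p => if p is Some p then reads p else true
  end.

Definition action := (G * move * option bool)%type.
Definition stay (g : G) : action := (g, MStay, None).

(* Next position ([None]: the fragment exits) and action, given the scanned
   cell and the input bit. *)
Fixpoint trans (r : raw) : pos r -> G -> bool -> option (pos r) * action :=
  match r with
  | Act f => fun _ g _ => (None, f g)
  | Sequ a b => fun p g i =>
      match p with
      | inl p => let: (n, e) := trans p g i in
          (Some (if n is Some p' then inl p' else inr (start b)), e)
      | inr p => let: (n, e) := trans p g i in (omap inr n, e)
      end
  | If P a b => fun p g i =>
      match p with
      | None => (Some (Some (if P g then inl (start a) else inr (start b))), stay g)
      | Some (inl p) =>
          let: (n, e) := trans p g i in (omap (fun p => Some (inl p)) n, e)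
      | Some (inr p) =>
          let: (n, e) := trans p g i in (omap (fun p => Some (inr p)) n, e)
      end
  | While P a => fun p g i =>
      match p with
      | None => (if P g then Some (Some (start a)) else None, stay g)
      | Some p => let: (n, e) := trans p g i in (Some n, e)
      end
  | WhileRead a => fun p g i =>
      match p with
      | None => (if i then Some (Some (start a)) else None, stay g)
      | Some p => let: (n, e) := trans p g i in (Some n, e)
      end
  end.

Record data := Data { d_tape : nat -> G; d_head : nat; d_pos : nat; d_out : seq bool }.

Definition perform (e : action) (rd : bool) (d : data) : data :=
  let: (g, m, o) := e in
  Data (fun p => if p == d_head d then g else d_tape d p)
    (match m with MLeft => (d_head d).-1 | MRight => (d_head d).+1 | MStay => d_head d end)
    (if rd then (d_pos d).+1 else d_pos d)
    (if o is Some b then rcons (d_out d) b else d_out d).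

Arguments perform : simpl never.

Variable s : nat -> bool.

Definition scanned (d : data) : G := d_tape d (d_head d).

Definition dstep (r : raw) (p : pos r) (d : data) : option (pos r) * data :=
  let: (n, e) := trans p (scanned d) (reads p && s (d_pos d)) in
  (n, perform e (reads p) d).

Inductive exits (r : raw) : pos r -> data -> data -> Prop :=
| ExitsNow p d d' : dstep p d = (None, d') -> exits p d d'
| ExitsStep p d p1 d1 d' : dstep p d = (Some p1, d1) -> exits p1 d1 d' -> exits p d d'.

Definition exec (r : raw) := exits (start r).

Lemma perform_stay d : perform (stay (scanned d)) false d = d.
Proof.
case: d => t h k o; rewrite /perform /scanned /=; congr Data.
by apply: functional_extensionality => p; case: eqP => [->|].
Qed.

Lemma exec_act f d : exec (Act f) d (perform (f (scanned d)) false d).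
Proof. exact: ExitsNow. Qed.

(** A part sits in a composite program through an injection of positions that commutes with its
    non-exiting steps; only the exiting step depends on the construct. *)
Lemma exits_lift (r r' : raw) (inj : pos r -> pos r') p d d1 d2 :
  (forall q e q1 e1, dstep q e = (Some q1, e1) ->
     dstep (inj q) e = (Some (inj q1), e1)) ->
  (forall q e, dstep q e = (None, d1) -> exits (inj q) e d2) ->
  exits p d d1 -> exits (inj p) d d2.
Proof.
move=> Hstep Hexit H; elim: H Hexit => [q e e' E|q e q1 e1 e' E _ IH] Hexit.
  exact: Hexit.
exact: ExitsStep (Hstep _ _ _ _ E) (IH Hexit).
Qed.

Ltac lifted_step :=
  rewrite /dstep /=; case: (trans _ _ _) => -[?|] ? // [*]; subst.

Lemma exec_seq a b d d1 d2 :
  exec a d d1 -> exec b d1 d2 -> exec (Sequ a b) d d2.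
Proof.
move=> Ha Hb; apply: (@exits_lift a (Sequ a b) inl) Ha => [q e q1 e1|q e].
  by lifted_step.
move=> E; apply: (@ExitsStep (Sequ a b) _ _ (inr (start b)) d1).
  by move: E; lifted_step.
apply: (@exits_lift b (Sequ a b) inr) Hb => [u f q1 e1|u f].
  by lifted_step.
by move=> F; apply: ExitsNow; move: F; lifted_step.
Qed.

Lemma exec_if P a b d d' :
  exec (if P (scanned d) then a else b) d d' -> exec (If P a b) d d'.
Proof.
move=> H.
apply: (@ExitsStep (If P a b) _ _
          (Some (if P (scanned d) then inl (start a) else inr (start b))) d).
  by rewrite /dstep /= perform_stay.
case: (P _) H => H.
- apply: (@exits_lift a (If P a b) (fun p => Some (inl p))) H => [q e q1 e1|q e].
    by lifted_step.
  by move=> E; apply: ExitsNow; move: E; lifted_step.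
- apply: (@exits_lift b (If P a b) (fun p => Some (inr p))) H => [q e q1 e1|q e].
    by lifted_step.
  by move=> E; apply: ExitsNow; move: E; lifted_step.
Qed.

Lemma exec_while0 P a d : ~~ P (scanned d) -> exec (While P a) d d.
Proof.
by move=> /negPf H; apply: ExitsNow; rewrite /dstep /= H perform_stay.
Qed.

Lemma exec_while (P : pred G) a d d1 d2 : P (scanned d) -> exec a d d1 ->
  exec (While P a) d1 d2 -> exec (While P a) d d2.
Proof.
move=> HP Ha Hb; apply: (@ExitsStep (While P a) _ _ (Some (start a)) d).
  by rewrite /dstep /= HP perform_stay.
apply: (@exits_lift a (While P a) some) Ha => [q e q1 e1|q e]; first by lifted_step.
by move=> E; apply: ExitsStep Hb; move: E; lifted_step.
Qed.

Definition advance (d : data) := Data (d_tape d) (d_head d) (d_pos d).+1 (d_out d).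

Lemma perform_advance d : perform (stay (scanned d)) true d = advance d.
Proof. by rewrite -[in RHS](perform_stay d) /advance /=. Qed.

Lemma exec_read0 a d : ~~ s (d_pos d) -> exec (WhileRead a) d (advance d).
Proof.
by move=> /negPf H; apply: ExitsNow; rewrite /dstep /= H perform_advance.
Qed.

Lemma exec_read a d d1 d2 : s (d_pos d) -> exec a (advance d) d1 ->
  exec (WhileRead a) d1 d2 -> exec (WhileRead a) d d2.
Proof.
move=> HP Ha Hb; apply: (@ExitsStep (WhileRead a) _ _ (Some (start a)) (advance d)).
  by rewrite /dstep /= HP perform_advance.
apply: (@exits_lift a (WhileRead a) some) Ha => [q e q1 e1|q e]; first by lifted_step.
by move=> E; apply: ExitsStep Hb; move: E; lifted_step.
Qed.

(** * Programs as interactive Turing machines *)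

(** An exiting step turns into a halt and loses its action. This is harmless for programs of the
    form [forever], which never exit. *)
Definition machine (blank : G) (r : raw) : itm :=
  ITM blank (start r) (fun p _ => reads p)
    (fun p g i =>
       let: (n, (g', m, o)) := trans p g (odflt false i) in
       omap (fun p' => (p', g', m, o)) n).

Variable blank : G.

Definition conf (r : raw) (p : pos r) (d : data) : iconf (machine blank r) :=
  @IConf (machine blank r) p (d_tape d) (d_head d) (d_pos d) (d_out d).

(** At least one step is demanded, so that the step count grows with every round of an infinite
    loop. *)
Definition reach (r : raw) (p : pos r) d q e :=
  exists2 m, 0 < m & iter_step (@istep (machine blank r) s) m (conf p d) = conf q e.

Lemma istep_conf (r : raw) (p q : pos r) d e :
  dstep p d = (Some q, e) -> istep s (conf p d) = Some (conf q e).
Proof.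
rewrite /dstep /istep /= /scanned.
have -> : odflt false (if reads p then Some (s (d_pos d)) else None)
          = reads p && s (d_pos d) by case: (reads p).
by case: (trans _ _ _) => -[p'|] [[g m] o] //= [<- <-].
Qed.

Lemma reach_step (r : raw) (p q : pos r) d e :
  dstep p d = (Some q, e) -> reach p d q e.
Proof. by move=> /istep_conf E; exists 1 => //=; rewrite E. Qed.

Lemma reach_trans (r : raw) (p q u : pos r) d e f :
  reach p d q e -> reach q e u f -> reach p d u f.
Proof.
move=> [m m0 E] [n n0 F]; exists (m + n); first by rewrite addn_gt0 m0.
by rewrite iter_step_add E.
Qed.

Lemma reach_lift (r r' : raw) (inj : pos r -> pos r') p d d1 q :
  (forall q e q1 e1, dstep q e = (Some q1, e1) ->
     dstep (inj q) e = (Some (inj q1), e1)) ->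
  (forall u e, dstep u e = (None, d1) -> dstep (inj u) e = (Some q, d1)) ->
  exits p d d1 -> reach (inj p) d q d1.
Proof.
move=> Hstep Hexit H.
elim: H Hexit => [u e e' E|u e q1 e1 e' E _ IH] Hexit.
  exact/reach_step/Hexit.
exact: reach_trans (reach_step (Hstep _ _ _ _ E)) (IH Hexit).
Qed.

Lemma itm_out_prefix r m n : m <= n ->
  prefix (itm_out (machine blank r) s m) (itm_out (machine blank r) s n).
Proof.
move=> /subnK <-; elim: (n - m) => [|k IH]; first exact: prefix_refl.
apply: prefix_trans IH _; rewrite addSn /itm_out iter_stepSr.
case E: (istep _ _) => [c|] /=; last exact: prefix_refl.
move: E; rewrite /istep; case: idelta => // -[[[q g] mv] o] [<-] /=.
by case: o => [b|]; rewrite ?prefix_rcons ?prefix_refl.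
Qed.

Definition forever (r1 r2 : raw) := Sequ r1 (While predT r2).

(** The bound [n <= m] makes the observed times unbounded, so every output of the machine is a
    prefix of some [d_out (D n)]. *)
Lemma forever_steps r1 r2 d0 (D : nat -> data) :
  d0 = Data (fun _ => blank) 0 0 [::] ->
  exec r1 d0 (D 0) -> (forall n, exec r2 (D n) (D n.+1)) ->
  forall n, exists2 m, n <= m &
    itm_out (machine blank (forever r1 r2)) s m = d_out (D n).
Proof.
move=> -> H1 H2 n.
pose home : pos (forever r1 r2) := inr None.
suff [m le_nm E] : exists2 m, n <= m &
    iter_step (@istep (machine blank (forever r1 r2)) s) m (itm_init _)
    = conf home (D n).
  by exists m => //; rewrite /itm_out E.
elim: n => [|n [m le_nm E]].
  have [] := @reach_lift r1 (forever r1 r2) inl _ _ _ home _ _ H1.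
  - by move=> q e q1 e1; lifted_step.
  - by move=> u e; rewrite /dstep /=; case: (trans _ _ _) => -[//|] x [<-].
  - by move=> m _ E; exists m.
have [] : reach home (D n) home (D n.+1).
  apply: (@reach_trans (forever r1 r2) home (inr (Some (start r2))) home _ (D n)).
    by apply: reach_step; rewrite /dstep /= perform_stay.
  apply: (@reach_lift r2 (forever r1 r2) (fun p => inr (Some p))) (H2 n).
  - by move=> q e q1 e1; lifted_step.
  - by move=> u e; rewrite /dstep /=; case: (trans _ _ _) => -[//|] x [<-].
move=> k k0 F; exists (m + k); first by rewrite -addn1 leq_add.
by rewrite iter_step_add E.
Qed.

End Raw.

(** * A loop language over stacks *)

(** The bit position at which the code of [x k] begins in the encoded stream. *)
Fixpoint offset (x : nat -> nat) (k : nat) : nat :=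
  if k is k'.+1 then offset x k' + (x k').+1 else 0.

Lemma enc_stream_offset x k j : j <= x k -> enc_stream x (offset x k + j) = (j < x k).
Proof.
move=> le_j; rewrite /enc_stream.
suff H f : offset x k + j < f -> enc_at f x 0 (offset x k + j) = (j < x k) by exact: H.
(* [enc_at] consumes the stream from the front while [offset] grows at the back: [offS] unrolls
   [offset] at the front, and [shift] trades the starting index for a shifted stream. *)
have offS (y : nat -> nat) n : offset y n.+1 = (y 0).+1 + offset (fun i => y i.+1) n.
  elim: n => [|n IH]; first by rewrite /= addn0.
  by rewrite -[LHS]/(offset y n.+1 + (y n.+1).+1) IH -addnA.
have shift y a n p : enc_at n (fun i => y i.+1) a p = enc_at n y a.+1 p.
  by elim: n a p => //= n IH a p; rewrite IH.
elim: k f x j le_j => [|k IH] [|f] x j //= le_j lt_f.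
  by rewrite add0n; case: ltngtP le_j.
rewrite -/(offset x k.+1) offS in lt_f *; set p := _ + _ + j in lt_f *.
have -> : (p < x 0) = false.
  by rewrite /p; apply/negbTE; rewrite -leqNgt -!addnA addSn leqW ?leq_addr.
have -> : (p == x 0) = false by rewrite /p -addnA addSn eqn_leq ltnNge leq_addr.
rewrite -shift (_ : p - _ = offset (fun i => x i.+1) k + j).
  apply: IH => //; rewrite -ltnS; apply: leq_trans lt_f.
  by rewrite /p -addnA addSn !ltnS leq_addl.
by rewrite /p -addnA addKn.
Qed.

Section Stacks.
Variables (K : nat) (x : nat -> nat).

Record store := Store { stacks : seq (seq bool); inpos : nat; out : seq bool }.

Definition get (s : store) (i : nat) := nth [::] (stacks s) i.
Definition upd (i : nat) l (s : store) :=
  Store (set_nth [::] (stacks s) i l) (inpos s) (out s).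

Inductive cmd :=
| Skip
| Push of 'I_K & bool
| Pop of 'I_K
| Copy of 'I_K & option 'I_K
| Case of 'I_K & cmd & cmd & cmd
| IfEq of 'I_K & 'I_K & cmd & cmd
| Loop of 'I_K & cmd & cmd
| ReadNum of 'I_K
| Out of bool
| Seq of cmd & cmd.

(** The missing source acts as an empty stack, so [Copy] also serves to clear. *)
Definition source (v : option 'I_K) s := oapp (fun j : 'I_K => get s j) [::] v.

(* [Loop i] empties stack [i] before running its bodies.  The machine pops one
   bit per round instead, which agrees with this when the bodies do not touch
   stack [i]. *)
Fixpoint den (c : cmd) (s : store) : store :=
  match c with
  | Skip => s
  | Push i b => upd i (b :: get s i) s
  | Pop i => upd i (behead (get s i)) s
  | Copy i v => upd i (source v s) s
  | Case i n t f =>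
      match get s i with
      | [::] => den n s | true :: _ => den t s | false :: _ => den f s
      end
  | IfEq i j a b => if get s i == get s j then den a s else den b s
  | Loop i t f =>
      foldl (fun s (b : bool) => if b then den t s else den f s)
        (upd i [::] s) (get s i)
  | ReadNum i =>
      Store (set_nth [::] (stacks s) i (nseq (x (inpos s)) true ++ get s i))
        (inpos s).+1 (out s)
  | Out b => Store (stacks s) (inpos s) (rcons (out s) b)
  | Seq a b => den b (den a s)
  end.

Fixpoint touches (i : 'I_K) (c : cmd) : bool :=
  match c with
  | Skip | Out _ => false
  | Push j _ | Pop j | ReadNum j => i == j
  | Copy j v => (i == j) || (Some i == v)
  | Case j n t f => [|| i == j, touches i n, touches i t | touches i f]
  | IfEq j k a b => [|| i == j, i == k, touches i a | touches i b]
  | Loop j t f => [|| i == j, touches i t | touches i f]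
  | Seq a b => touches i a || touches i b
  end.

(** The syntactic condition under which emptying the loop stack at once agrees with popping it bit
    by bit. *)
Fixpoint ok (c : cmd) : bool :=
  match c with
  | Case _ n t f => [&& ok n, ok t & ok f]
  | IfEq _ _ a b | Seq a b => ok a && ok b
  | Loop i t f => [&& ~~ touches i t, ~~ touches i f, ok t & ok f]
  | _ => true
  end.

Lemma upd_upd (i : nat) l l' s : upd i l (upd i l' s) = upd i l s.
Proof. by rewrite /upd /= set_set_nth eqxx. Qed.

Lemma updC (i j : 'I_K) l l' s : i != j -> upd i l (upd j l' s) = upd j l' (upd i l s).
Proof.
by move=> ne; rewrite /upd /= set_set_nth val_eqE eq_sym (negPf ne).
Qed.

Lemma get_upd (i : nat) l s : get (upd i l s) i = l.
Proof. by rewrite /get nth_set_nth /= eqxx. Qed.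

Lemma get_upd_ne (i j : 'I_K) l s : i != j -> get (upd i l s) j = get s j.
Proof. by move=> ne; rewrite /get nth_set_nth /= val_eqE eq_sym (negPf ne). Qed.

(** A frame property: it lets the bits still waiting on a loop stack be carried past the loop
    body. *)
Lemma den_upd i l c s : ~~ touches i c -> den c (upd i l s) = upd i l (den c s).
Proof.
elim: c s => [|j b|j|j v|j n IHn t IHt f IHf|j k a IHa b IHb|j t IHt f IHf|j|b|a IHa b IHb] s //=.
- by move=> ne; rewrite (get_upd_ne _ _ ne) -(updC _ _ _ ne).
- by move=> ne; rewrite (get_upd_ne _ _ ne) -(updC _ _ _ ne).
- rewrite negb_or => /andP[ne nv]; rewrite -updC //; congr (upd _ _ (upd _ _ _)).
  by case: v nv => [k|] //= nk; rewrite get_upd_ne.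
- rewrite !negb_or => /and4P[ne /IHn En /IHt Et /IHf Ef]; rewrite get_upd_ne //.
  by case: (get s j) => // -[].
- rewrite !negb_or => /and4P[ne ne' /IHa Ea /IHb Eb]; rewrite !get_upd_ne //.
  by case: eqP.
- rewrite !negb_or => /and3P[ne /IHt Et /IHf Ef]; rewrite get_upd_ne // -updC //.
  move: (get s j) (upd j _ s) => l' {}s.
  by elim: l' s => [|b l' IH] s //=; case: b; rewrite ?Et ?Ef IH.
- by move=> ne; rewrite get_upd_ne // /upd /= set_set_nth val_eqE (negPf ne).
- by rewrite negb_or => /andP[/IHa Ea /IHb Eb]; rewrite Ea Eb.
Qed.

(* Track [i] of the tape holds stack [i] with its bottom at cell 0, so that
   two stacks are copied or compared in one sweep; the boolean marks cell 0. *)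
Definition cell := (bool * {ffun 'I_K -> option bool})%type.

Definition tape_of (R : 'I_K -> nat -> option bool) (p : nat) : cell :=
  (p == 0, [ffun i => R i p]).

Definition row (l : seq bool) (p : nat) := onth (rev l) p.

Definition mkd R h k o : data cell := Data (tape_of R) h k o.

Definition rows (s : store) (i : 'I_K) := row (get s i).

(* [inpos s] counts symbols of the input stream, the machine counts bits. *)
Definition at_head h (s : store) : data cell :=
  mkd (rows s) h (offset x (inpos s)) (out s).

Local Notation exec := (@exec cell (enc_stream x)).

Definition put (i : 'I_K) (v : option bool) (g : cell) : cell :=
  (g.1, [ffun j => if j == i then v else g.2 j]).

Definition shift (m : move) h :=
  match m with MLeft => h.-1 | MRight => h.+1 | MStay => h end.

Lemma mkd_ext (R R' : 'I_K -> nat -> option bool) h k o :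
  (forall i p, R i p = R' i p) -> mkd R h k o = mkd R' h k o.
Proof.
move=> E; congr Data; apply: functional_extensionality => p; congr (_, _).
by apply/ffunP => i; rewrite !ffunE.
Qed.

Lemma exec_put i v m R h k o :
  exec (Act (fun g : cell => (put i (v g) g, m, None))) (mkd R h k o)
    (mkd (fun j p => if (j == i) && (p == h) then v (tape_of R h) else R j p) (shift m h) k o).
Proof.
suff <- : perform ((put i (v (tape_of R h)) (tape_of R h), m, None)) false (mkd R h k o) = mkd
  (fun j p => if (j == i) && (p == h) then v (tape_of R h) else R j p) (shift m h) k o.
  exact: exec_act.
congr Data; apply: functional_extensionality => p; rewrite /tape_of /put /=.
case: (p =P h) => [->|_]; last by congr (_, _); apply/ffunP => j; rewrite !ffunE andbF.
by congr (_, _); apply/ffunP => j; rewrite !ffunE andbT.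
Qed.

Lemma exec_out m b R h k o :
  exec (Act (fun g : cell => (g, m, b))) (mkd R h k o)
    (mkd R (shift m h) k (if b is Some b then rcons o b else o)).
Proof.
set d := mkd R h k o.
have -> : mkd R (shift m h) k (if b is Some b then rcons o b else o)
          = perform (scanned d, m, b) false d; last exact: exec_act.
rewrite /perform /=; congr Data; apply: functional_extensionality => p.
by rewrite /scanned; case: eqP => [->|].
Qed.

(** * Head movements and single-stack operations on the tape *)

Definition go (m : move) : raw cell := Act (fun g : cell => (g, m, None)).

Lemma exec_walk (P : pred cell) R h n k o : h <= n ->
  (forall p, h <= p < n -> P (tape_of R p)) -> ~~ P (tape_of R n) ->
  exec (While P (go MRight)) (mkd R h k o) (mkd R n k o).
Proof.
move=> /subnKC; move: (n - h) => e <- {n}; elim: e h => [|e IH] h Hp Hn.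
  by rewrite addn0 in Hn *; apply: exec_while0.
apply: exec_while (exec_out MRight None R h k o) _.
  by apply: Hp; rewrite leqnn addnS ltnS leq_addr.
rewrite -addSnnS in Hp Hn *; apply: IH => // p /andP[lt_p p_lt].
by apply: Hp; rewrite p_lt ltnW.
Qed.

Definition home : raw cell := While (fun g : cell => ~~ g.1) (go MLeft).

Lemma exec_home R h k o : exec home (mkd R h k o) (mkd R 0 k o).
Proof.
elim: h => [|h IH]; first exact: exec_while0.
by apply: exec_while (exec_out MLeft None R h.+1 k o) IH.
Qed.

Lemma exec_home_to (R R' : 'I_K -> nat -> option bool) h k o :
  (forall i p, R i p = R' i p) -> exec home (mkd R h k o) (mkd R' 0 k o).
Proof. by move=> E; rewrite -(mkd_ext _ _ _ E); apply: exec_home. Qed.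

Lemma isSome_row l p : isSome (row l p) = (p < size l).
Proof. by rewrite /row -(size_rev l) -onthTE; case: onth. Qed.

Lemma row_default l p : size l <= p -> row l p = None.
Proof. by move=> H; apply: onth_default; rewrite size_rev. Qed.

Lemma row_cons b l p : row (b :: l) p = if p == size l then Some b else row l p.
Proof.
rewrite /row rev_cons -cats1 onth_cat size_rev.
case: ltngtP => [|lt_p|->]; rewrite ?subnn //.
rewrite !onth_default ?size_rev //; first exact: ltnW.
by rewrite subn_gt0.
Qed.

Lemma row_inj l l' : row l =1 row l' -> l = l'.
Proof. by move=> E; apply: (inv_inj revK); apply: eq_from_onth. Qed.

(** The two stores may differ, since [set_nth] can pad the list of stacks; only their tapes
    agree. *)
Lemma at_head_upd h (i : 'I_K) s : at_head h (upd i (get s i) s) = at_head h s.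
Proof.
apply: mkd_ext => j p; rewrite /rows; case: (eqVneq j i) => [->|ne]; first by rewrite get_upd.
by rewrite get_upd_ne // eq_sym.
Qed.

Definition seek (i : 'I_K) : raw cell := While (fun g : cell => isSome (g.2 i)) (go MRight).
(** For an empty stack the left move at cell 0 has no effect, and the head rests on an empty entry
    of the track; so the scanned cell also reveals emptiness. *)
Definition top (i : 'I_K) : raw cell := Sequ (seek i) (go MLeft).

Lemma exec_seek i s k o :
  exec (seek i) (mkd (rows s) 0 k o) (mkd (rows s) (size (get s i)) k o).
Proof.
apply: exec_walk => // [p /andP[_ lt_p]|] /=; rewrite ffunE /rows isSome_row ?lt_p //.
by rewrite ltnn.
Qed.

Lemma exec_top i s : exec (top i) (at_head 0 s) (at_head (size (get s i)).-1 s).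
Proof. exact: exec_seq (exec_seek i _ _ _) (exec_out MLeft None _ _ _ _). Qed.

Lemma top_cell (i : 'I_K) s : 
  (scanned (at_head (size (get s i)).-1 s)).2 i = ohead (get s i).
Proof.
rewrite /scanned /= ffunE /rows; case: (get s i) => [|b l] //=.
by rewrite row_cons eqxx.
Qed.

Definition push i b : raw cell :=
  Sequ (seek i) (Sequ (Act (fun g : cell => (put i (Some b) g, MStay, None))) home).

Lemma exec_push i b s k o :
  exec (push i b) (mkd (rows s) 0 k o) (mkd (rows (upd i (b :: get s i) s)) 0 k o).
Proof.
apply: exec_seq (exec_seek i _ _ _) (exec_seq (exec_put i (fun _ => Some b) _ _ _ _ _) _).
apply: exec_home_to => j p; rewrite /rows; case: (eqVneq j i) => [->|ne].
  by rewrite get_upd row_cons.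
by rewrite get_upd_ne // eq_sym.
Qed.

Definition erase i : raw cell := Sequ (Act (fun g : cell => (put i None g, MStay, None))) home.

Lemma exec_erase i s : exec (erase i) (at_head (size (get s i)).-1 s)
  (at_head 0 (upd i (behead (get s i)) s)).
Proof.
apply: exec_seq (exec_put i (fun _ => None) _ _ _ _ _) _.
apply: exec_home_to => j p; rewrite /rows.
case: (eqVneq j i) => [->|ne]; last by rewrite get_upd_ne // eq_sym.
rewrite get_upd /=; case: (get s i) => [|b l] /=; first by rewrite row_default //; case: eqP.
by rewrite row_cons; case: eqP => // ->; rewrite row_default.
Qed.

(** Each compiled command starts and ends with the head on cell 0. A loop erases the top bit of its
    stack before running the body. *)
Fixpoint compile (c : cmd) : raw cell :=
  match c with
  | Skip => go MStay
  | Push i b => push i b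
  | Pop i => Sequ (top i) (erase i)
  | Copy i v =>
      let src := fun g : cell => obind g.2 v in
      Sequ (While (fun g : cell => isSome (g.2 i) || isSome (src g))
                  (Act (fun g : cell => (put i (src g) g, MRight, None))))
           home
  | Case i n t f =>
      Sequ (top i)
        (If (fun g : cell => g.2 i == None) (Sequ home (compile n))
           (If (fun g : cell => g.2 i == Some true) (Sequ home (compile t))
              (Sequ home (compile f))))
  | IfEq i j a b =>
      Sequ (While (fun g : cell => isSome (g.2 i) && (g.2 i == g.2 j)) (go MRight))
        (If (fun g : cell => g.2 i == g.2 j) (Sequ home (compile a)) (Sequ home (compile b)))
  | Loop i t f =>
      Sequ (top i)
        (While (fun g : cell => isSome (g.2 i))
           (Sequ (If (fun g : cell => g.2 i == Some true) (Sequ (erase i) (compile t))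
                    (Sequ (erase i) (compile f)))
              (top i)))
  | ReadNum i => WhileRead (push i true)
  | Out b => Act (fun g : cell => (g, MStay, Some b))
  | Seq a b => Sequ (compile a) (compile b)
  end.

Lemma exec_copy i v s :
  exec (compile (Copy i v)) (at_head 0 s) (at_head 0 (upd i (source v s) s)).
Proof.
set S := source v s.
(* The tape once the first [h] cells of track [i] are overwritten. Cell [h] is still intact, so the
   source is read correctly even if it is track [i] itself. *)
pose R h (j : 'I_K) p := if (j == i) && (p < h) then row S p else row (get s j) p.
have E : at_head 0 s = mkd (R 0) 0 (offset x (inpos s)) (out s).
  by apply: mkd_ext => j p; rewrite /R ltn0 andbF.
have srcE h : obind (tape_of (R h) h).2 v = row S h.
  rewrite /S; case: (v) => [j|]; last by rewrite row_default.
  by rewrite /= ffunE /R ltnn andbF.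
(* The sweep covers the longer of the two stacks, so that leftover old bits are blanked. *)
pose n := maxn (size (get s i)) (size S).
apply: (@exec_seq _ _ _ _ _ (mkd (R n) n (offset x (inpos s)) (out s))).
  rewrite E; have: 0 <= n by []; move: (0) => h /subnKC; move: (n - h) => e En.
  have condE : (isSome ((tape_of (R h) h).2 i) || isSome (obind (tape_of (R h) h).2 v)) = (h < n).
    by rewrite srcE ffunE /R ltnn andbF !isSome_row -leq_max.
  elim: e h En condE => [|e IH] h En condE.
    rewrite addn0 in En; subst h.
    by apply: exec_while0; rewrite /scanned /= condE ltnn.
  apply: exec_while; first by rewrite /scanned /= condE -En addnS ltnS leq_addr.
    exact: exec_put.
  suff -> : mkd (fun j p => if (j == i) && (p == h) then obind (tape_of (R h) h).2 v
                            else R h j p) h.+1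
     (offset x (inpos s)) (out s) = mkd (R h.+1) h.+1 (offset x (inpos s)) (out s).
    apply: IH; first by rewrite addSnnS.
    by rewrite srcE ffunE /R ltnn andbF !isSome_row -leq_max.
  apply: mkd_ext => j p; rewrite srcE /R ltnS; case: eqP => //= _.
  by case: ltngtP => // ->.
apply: exec_home_to => j p; rewrite /R /rows.
case: (eqVneq j i) => [->|ne]; last by rewrite get_upd_ne // eq_sym.
rewrite get_upd /=; case: ltnP => //; rewrite geq_max => /andP[H1 H2].
by rewrite !row_default.
Qed.

(** The sweep stops at the first cell where track [i] is blank or the tracks differ. If they agree
    there, both are blank, and both stay blank beyond, because a stack fills an initial segment of
    its track. *)
Lemma exec_sweep i j s : exists h,
  exec (While (fun g : cell => isSome (g.2 i) && (g.2 i == g.2 j)) (go MRight))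
    (at_head 0 s) (at_head h s) /\
  ((row (get s i) h == row (get s j) h) = (get s i == get s j)).
Proof.
pose P p := isSome (row (get s i) p) && (row (get s i) p == row (get s j) p).
have exP : exists p, ~~ P p by exists (size (get s i)); rewrite /P isSome_row ltnn.
case: (ex_minnP exP) => h Ph minh; exists h.
have before p : p < h -> P p by apply: contraTT => /minh; rewrite -leqNgt.
split.
  apply: exec_walk => // [p /andP[_ /before]|]; by rewrite /= !ffunE.
apply/eqP/eqP => [E|-> //]; apply: row_inj => p.
move: Ph; rewrite /P E eqxx andbT -E isSome_row -leqNgt => le_h.
have [/before/andP[_ /eqP//]|le_p] := ltnP p h.
rewrite row_default ?(leq_trans le_h) // row_default // (leq_trans _ le_p) //.
by rewrite leqNgt -isSome_row -E isSome_row -leqNgt.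
Qed.

Theorem compile_correct c s : ok c -> exec (compile c) (at_head 0 s) (at_head 0 (den c s)).
Proof.
elim: c s => [|i b|i|i v|i n IHn t IHt f IHf|i j a IHa b IHb|i t IHt f IHf|i|b|a IHa b IHb] s /=.
- by move=> _; apply: exec_out.
- by move=> _; apply: exec_push.
- by move=> _; apply: exec_seq (exec_top i s) (exec_erase i s).
- by move=> _; apply: exec_copy.
- case/and3P=> on ot off; apply: exec_seq (exec_top i s) _.
  have := top_cell i s; move: (size _).-1 => h cellE; apply: exec_if; rewrite cellE.
  case: (get s i) cellE => [|b l] cellE /=.
    exact: exec_seq (exec_home _ _ _ _) (IHn s on).
  apply: exec_if; rewrite cellE /=.
  by case: b {cellE}; [have := IHt s ot | have := IHf s off] => H;
    exact: exec_seq (exec_home _ _ _ _) H.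
- case/andP=> oa ob; have [h [Hw E]] := exec_sweep i j s.
  apply: exec_seq Hw (exec_if _); rewrite /scanned /= !ffunE /rows E.
  by case: ifP => _; [have := IHa s oa | have := IHb s ob] => H;
    exact: exec_seq (exec_home _ _ _ _) H.
- case/and4P=> nt nf ot off; apply: exec_seq (exec_top i s) _.
  (* The loop stack is split off from the store, so that the induction runs over its content while
     the rest of the store varies. *)
  rewrite -{1}(at_head_upd _ i) -(upd_upd i [::] (get s i)).
  move: (get s i) => l.
  elim: l s => [|b l IH] s.
    have := top_cell i (upd i [::] s); rewrite get_upd upd_upd => cellE.
    by apply: exec_while0; rewrite cellE.
  set s1 := upd i (b :: l) s.
  have E : get s1 i = b :: l by rewrite get_upd.
  have cellE := top_cell i s1; rewrite E in cellE.
  pose s2 := if b then den t s else den f s.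
  apply: (@exec_while _ _ _ _ _ (at_head (size l).-1 (upd i l s2))).
  - by rewrite cellE.
  - apply: (@exec_seq _ _ _ _ _ (at_head 0 (upd i l s2))); last first.
      by have := exec_top i (upd i l s2); rewrite get_upd.
    have er := exec_erase i s1; rewrite E upd_upd /= in er.
    apply: exec_if; rewrite cellE /= /s2; case: (b); apply: exec_seq er _.
      by rewrite -den_upd //; apply: IHt.
    by rewrite -den_upd //; apply: IHf.
  - have := IH s2; rewrite !upd_upd /s2 /=.
    by case: (b); rewrite den_upd.
(* The invariant: after [j] bits of the current symbol, [j] ones lie on top of stack [i]. The
   terminating zero accounts for the final advance by one. *)
- move=> _; set s' := Store _ _ _; pose sj j := upd i (nseq j true ++ get s i) s.
  pose rd k j := mkd (rows (sj j)) 0 k (out s).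
  pose k0 := offset x (inpos s).
  have -> : at_head 0 s = rd (k0 + 0) 0 by rewrite addn0 -(at_head_upd _ i).
  have -> : at_head 0 s' = rd (k0 + x (inpos s)).+1 (x (inpos s)).
    by rewrite /rd -addnS.
  have: 0 <= x (inpos s) by [].
  move: (0) => j /subnKC; move: (_ - j) => e.
  elim: e j => [|e IH] j Ej.
    rewrite addn0 in Ej; rewrite -Ej; apply: (exec_read0 _ (d := rd (k0 + j) j)).
    by rewrite /= enc_stream_offset -Ej ?ltnn.
  have lt_j : j < x (inpos s) by rewrite -Ej addnS ltnS leq_addr.
  apply: (@exec_read _ _ _ (rd (k0 + j) j) (rd (k0 + j.+1) j.+1)).
  + by rewrite /= enc_stream_offset // ltnW.
  + rewrite addnS; have := exec_push i true (sj j) (k0 + j).+1 (out s).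
    by rewrite /sj upd_upd get_upd.
  + by apply: IH; rewrite addSnnS.
- by move=> _; apply: exec_out.
- by case/andP=> oa ob; apply: exec_seq (IHa s oa) (IHb _ ob).
Qed.
End Stacks.

(** * The interpreter *)

Section Interpreter.
Variable x : nat -> nat.

(* [rN0]..[rN4] receive the fields of a scanned 5-tuple, shifted in from [rN4];
   [rT], [rH] are the input tape and the head position, [rQ] the state, [rA] the
   observed symbol, [rO] the output tape (last symbol on top); [rQ'], [rB], [rD]
   come from the matching tuple; [rE] is the symbol waiting to be output. *)
Notation reg i := (@Ordinal 22 i isT).
Notation rF := (reg 0).
Notation rN0 := (reg 1).
Notation rN1 := (reg 2).
Notation rN2 := (reg 3).
Notation rN3 := (reg 4).
Notation rN4 := (reg 5).
Notation rT := (reg 6).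
Notation rH := (reg 7).
Notation rQ := (reg 8).
Notation rA := (reg 9).
Notation rO := (reg 10).
Notation rBad := (reg 11).
Notation rDead := (reg 12).
Notation rFound := (reg 13).
Notation rQ' := (reg 14).
Notation rB := (reg 15).
Notation rD := (reg 16).
Notation rX := (reg 17).
Notation rY := (reg 18).
Notation rU := (reg 19).
Notation rPar := (reg 20).
Notation rE := (reg 21).

Notation cmd := (cmd 22).
Notation skip := (@Skip 22).
Notation den := (@den 22 x).

Notation "a ;; b" := (Seq a b) (at level 60, right associativity).
Notation "i <~ j" := (Copy i (Some j)) (at level 50).
Definition Clear i : cmd := Copy i None.
Definition IfNE i (a b : cmd) : cmd := Case i b a a.

(** * The programs: scanning and validating a code, and one round of simulation *)

Definition clean : cmd :=
  Clear rN0 ;; Clear rN1 ;; Clear rN2 ;; Clear rN3 ;; Clear rN4 ;;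
  Clear rF ;; Push rF true ;; Push rF true ;; Push rF true ;; Push rF false.

(** The four bits of [rF] count off the first four fields, each shifted down by one register; the
    end of the fifth completes the tuple and triggers [P]. *)
Definition field_end (P : cmd) : cmd :=
  let next := Pop rF ;; rN0 <~ rN1 ;; rN1 <~ rN2 ;; rN2 <~ rN3 ;; rN3 <~ rN4 ;; Clear rN4 in
  Case rF (P ;; clean) next next.

Definition scan i (P : cmd) : cmd := i <~ rT ;; Loop i (Push rN4 true) (field_end P).

(** [rFound] counts the matches, as the same scan also serves to detect repeated keys. *)
Definition match_entry : cmd :=
  IfEq rN0 rA
    (IfEq rN1 rQ (Push rFound true ;; rQ' <~ rN2 ;; rB <~ rN3 ;; rD <~ rN4) skip) skip.

Definition kill : cmd := Push rDead true.

Definition check_dir : cmd := Pop rN4 ;; IfNE rN4 kill skip.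

(** The inner scan over [rX] reuses the field registers of the outer scan over [rY]; the key is
    therefore saved as the symbol and state to look up. *)
Definition load_key : cmd := rA <~ rN0 ;; rQ <~ rN1 ;; clean.

(** One match is the tuple itself and is discounted; any other one reveals a repeated key. *)
Definition report_key : cmd :=
  Pop rFound ;; IfNE rFound kill skip ;;
  Clear rFound ;; Clear rQ' ;; Clear rB ;; Clear rD ;; Clear rA ;; Clear rQ.

Definition check_key : cmd := load_key ;; scan rX match_entry ;; report_key.

(** The string breaks off inside a tuple exactly when some of its fields are already completed or
    some ones are pending in [rN4]. *)
Definition check_end : cmd := Case rF kill kill (IfNE rN4 kill skip).

Definition validate : cmd :=
  scan rY check_dir ;; check_end ;; IfNE rDead skip (scan rY check_key).

(** Tape bits [true] and [false] stand for the symbols 1 and 2. Past the end nothing is pushed,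
    which is the unary code of the blank 0. *)
Definition read_tape : cmd :=
  rY <~ rT ;; rU <~ rH ;; Loop rU (Pop rY) (Pop rY) ;;
  Case rY skip (Push rA true) (Push rA true ;; Push rA true) ;; Clear rY.

Definition write_tape : cmd :=
  IfNE rB
    (Pop rB ;; IfNE rB (Pop rB ;; IfNE rB (Push rBad true) (Push rO false))
                 (Push rO true))
    skip.

Definition split : cmd :=
  IfNE rBad kill
    (Clear rH ;; Clear rQ ;; Clear rT ;; Loop rO (Push rT true) (Push rT false) ;;
     validate).

Definition move_heads : cmd :=
  Clear rFound ;; Clear rA ;;
  Case rPar (rE <~ rB) (write_tape ;; IfNE rD (Push rH true) (Pop rH)) skip ;;
  Clear rPar ;; Clear rB ;; Clear rD ;; rQ <~ rQ' ;; Clear rQ'.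

(** The state is [q1] exactly when its unary code is nonempty and a single pop empties it. *)
Definition change_state : cmd :=
  rU <~ rQ ;; Pop rU ;; IfNE rQ (IfNE rU (Clear rU) split) skip.

Definition flush : cmd :=
  IfNE rDead skip
    (IfNE rE (Loop rE (Out _ true) (Out _ true) ;; Out _ false) skip).

Definition act : cmd := move_heads ;; change_state ;; flush.

Definition parity : cmd :=
  let toggle := IfNE rPar (Pop rPar) (Push rPar true) in
  rU <~ rQ ;; Loop rU toggle toggle.

Definition observe : cmd := Case rPar (ReadNum rA) read_tape skip.

Definition run : cmd :=
  parity ;; observe ;; scan rX match_entry ;; IfNE rFound act kill.

Definition body : cmd := IfNE rDead skip run.

(** Clearing the last register first pads the initially empty list of stacks to its full length, so
    that stores can be compared literally. *)
Definition load (t : seq bool) : cmd :=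
  Clear rE ;; clean ;; foldr (fun b c => c ;; Push rT b) skip t.

Lemma ok_load t : ok (load t).
Proof. by rewrite /load /=; elim: t => //= b t ->. Qed.

Lemma ok_body : ok body. Proof. by []. Qed.

Notation u n := (nseq n true).

(* The size of stack [rF] is the number of fields to be completed before the
   last one; its top is [false] exactly when no field is complete yet. *)
Definition F0 := [:: false; true; true; true].

Definition fresh r k o := Store (F0 :: [::] :: [::] :: [::] :: [::] :: [::] :: r) k o.

Definition quint (t : transition) : seq nat :=
  let: (a, q, q', b, d) := t in [:: a; q; q'; b; d].

Definition bits (s : seq nat) : seq bool := map (pred1 1) s.

Lemma den_seq a b s : den (a ;; b) s = den b (den a s).
Proof. by []. Qed.

Lemma den_ifne i a b s :
  den (IfNE i a b) s = if get s i is [::] then den b s else den a s.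
Proof. by rewrite /=; case: (get s i) => [|[]]. Qed.

Lemma bits_enc_num n : bits (enc_num n) = rcons (u n) false.
Proof. by rewrite /bits /enc_num map_rcons map_nseq. Qed.

Lemma enc_trans_quint t : enc_trans t = flatten (map enc_num (quint t)).
Proof. by case: t => [[[[a q] q'] b] d]; rewrite /= cats0. Qed.

(** * Effect of the scans on a code *)

Section Scan.
Variables (P : cmd) (k : nat) (o : seq bool).

(** The loop of [scan] as a fold over an arbitrary string, which can be cut at the field
    boundaries. *)
Definition scan_bits := foldl (fun s (b : bool) =>
  if b then den (Push rN4 true) s else den (field_end P) s).

Lemma scan_true F n0 n1 n2 n3 n4 r n :
  scan_bits (Store (F :: n0 :: n1 :: n2 :: n3 :: n4 :: r) k o) (u n)
  = Store (F :: n0 :: n1 :: n2 :: n3 :: (u n ++ n4) :: r) k o.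
Proof.
elim: n n4 => [|n IH] n4 //=; rewrite /upd /= IH; congr (Store [:: _, _, _, _, _, _ & _] _ _).
by elim: n {IH} => //= n ->.
Qed.

Lemma scan_field c F n0 n1 n2 n3 r n :
  scan_bits (Store ((c :: F) :: n0 :: n1 :: n2 :: n3 :: [::] :: r) k o) (bits (enc_num n))
  = Store (F :: n1 :: n2 :: n3 :: u n :: [::] :: r) k o.
Proof.
rewrite bits_enc_num -cats1 /scan_bits foldl_cat -/scan_bits scan_true cats0 /=.
by case: c.
Qed.

Lemma scan_entry r t :
  scan_bits (fresh r k o) (bits (enc_trans t))
  = den (P ;; clean) (Store ([::] :: map (fun n => u n) (quint t) ++ r) k o).
Proof.
case: t => [[[[a q] q'] b] d].
rewrite /enc_trans /bits !map_cat /scan_bits !foldl_cat -/scan_bits -!/(bits _).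
rewrite /fresh !scan_field bits_enc_num -cats1 /scan_bits foldl_cat -/scan_bits scan_true cats0.
by [].
Qed.

(** Lifts the effect of [P] on one tuple to a whole code; [mkc] presents the remaining registers as
    a function of the part that [P] changes. *)
Lemma scan_code C (mkc : C -> seq (seq bool)) (f : C -> transition -> C) l c :
  (forall c t, den (P ;; clean) (Store ([::] :: map (fun n => u n) (quint t) ++ mkc c) k o)
     = fresh (mkc (f c t)) k o) ->
  scan_bits (fresh (mkc c) k o) (bits (encode l)) = fresh (mkc (foldl f c l)) k o.
Proof.
move=> H; elim: l c => [|t l IH] c //=.
by rewrite /encode /= /bits map_cat /scan_bits foldl_cat -/scan_bits scan_entry H IH.
Qed.

End Scan.

Definition core_Y T H Q A O Bad Dead Found Q' B D Y U Par E : seq (seq bool) :=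
  [:: T; H; Q; A; O; Bad; Dead; Found; Q'; B; D; [::]; Y; U; Par; E].

Notation core T H Q A O Bad Dead Found Q' B D U Par E :=
  (core_Y T H Q A O Bad Dead Found Q' B D [::] U Par E).

Definition record := (nat * (seq bool * seq bool * seq bool))%type.

Definition match_fun a q (z : record) (t : transition) : record :=
  let: (_, _, q', b, d) := t in
  if tkey t == (a, q) then (z.1.+1, (u q', u b, u d)) else z.

Lemma den_match T H Q A O Bad Dead U Par E a q k o l :
  Q = u q -> A = u a -> T = bits (encode l) ->
  let mkc (z : record) := core T H Q A O Bad Dead (u z.1) z.2.1.1 z.2.1.2 z.2.2 U Par E in
  forall z, den (scan rX match_entry) (fresh (mkc z) k o)
  = fresh (mkc (foldl (match_fun a q) z l)) k o.
Proof.
move=> -> -> -> mkc z.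
rewrite -(@scan_code match_entry k o _ mkc); first by [].
case=> [n [[q2 b2] d2]] [[[[a' q'] q''] b] d].
have unary_eq (m m' : nat) : (u m == u m' :> seq bool) = (m == m').
  by apply/eqP/eqP => [/(congr1 size)|-> //]; rewrite !size_nseq.
rewrite den_seq /match_entry /= /get /= !unary_eq xpair_eqE.
by case: eqP => [->|_] //=; case: eqP => [->|].
Qed.

Lemma den_check_dir T H Q A O Bad Dead Found Q' B D U Par E k o l :
  let mkc Dead := core T H Q A O Bad Dead Found Q' B D U Par E in
  scan_bits check_dir (fresh (mkc Dead) k o) (bits (encode l))
  = fresh (mkc (foldl (fun Dead t => if (t : transition).2 <= 1 then Dead else true :: Dead)
                      Dead l)) k o.
Proof.
move=> mkc; apply: scan_code => {}Dead [[[[a' q'] q''] b] d].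
by case: d => [|[|d]].
Qed.

Definition dups (l : seq transition) (Dead : seq bool) (t : transition) :=
  if count (fun t' => tkey t' == tkey t) l <= 1 then Dead else true :: Dead.

Lemma foldl_match a q z l :
  (foldl (match_fun a q) z l).1 = count (fun t => tkey t == (a, q)) l + z.1.
Proof.
elim: l z => [|[[[[a' q'] q''] b] d] l IH] z //=; rewrite IH /=.
by case: eqP => //= _; rewrite addnS addSn.
Qed.

Lemma den_check_key T H O Bad Dead U Par E k o l :
  T = bits (encode l) ->
  let mkc Dead := core T H [::] [::] O Bad Dead [::] [::] [::] [::] U Par E in
  scan_bits check_key (fresh (mkc Dead) k o) (bits (encode l))
  = fresh (mkc (foldl (dups l) Dead l)) k o.
Proof.
move=> ET mkc; apply: scan_code => {}Dead [[[[a q] q'] b] d].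
rewrite (den_seq check_key clean) (den_seq load_key) (den_seq (scan rX match_entry)).
rewrite [den load_key _](_ : _ =
  fresh (core T H (u q) (u a) O Bad Dead (u 0) [::] [::] [::] U Par E) k o) //.
rewrite (den_match H O Bad Dead U Par E k o erefl erefl ET (0, ([::], [::], [::]))).
move EZ: (foldl _ _ _) => [n [[q2 b2] d2]].
have := foldl_match a q (0, ([::], [::], [::])) l; rewrite EZ addn0 /dups /= => ->.
by case: (count _ _) => [|[|n']].
Qed.


(** * Codes as bit strings, and correctness of the validation *)

Definition dead (s : store) := get s rDead <> [::].

Definition sym (b : bool) : nat := if b then 1 else 2.

Definition is_bit : pred nat := pred2 1 2.

Lemma bitsK w : bits (map sym w) = w.
Proof. by rewrite /bits -map_comp -[RHS]map_id; apply: eq_map => -[]. Qed.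

Lemma symK s : all is_bit s -> map sym (bits s) = s.
Proof.
by elim: s => //= a s IH /andP[/orP[/eqP->|/eqP->] /IH Es]; rewrite /= Es.
Qed.

Lemma encode_quint c : encode c = flatten (map enc_num (flatten (map quint c))).
Proof.
elim: c => //= t c IH; rewrite /encode /= -/(encode c) IH map_cat flatten_cat.
by rewrite enc_trans_quint.
Qed.

Lemma parse_nums_ones n s acc : parse_nums (nseq n 1 ++ s) acc = parse_nums s (n + acc).
Proof. by elim: n acc => //= n IH acc; rewrite IH addnS. Qed.

Lemma parse_enc l n :
  parse_nums (flatten (map enc_num l) ++ nseq n 1) 0 = if n == 0 then Some l else None.
Proof.
elim: l => [|a l IH] /=.
  by rewrite -[nseq n 1]cats0 parse_nums_ones /= addn0; case: n.
by rewrite /enc_num -cats1 -!catA parse_nums_ones addn0 /= IH; case: eqP.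
Qed.

Lemma group5_quint c ns : size ns < 5 ->
  group5 (flatten (map quint c) ++ ns) = if ns is [::] then Some c else None.
Proof.
move=> Hns; elim: c => [|[[[[a q] q'] b] d] c IH] /=.
  by case: ns Hns => [|? [|? [|? [|? [|? ?]]]]].
by rewrite IH; case: (ns).
Qed.

Lemma decode_enc c ns n : size ns < 5 ->
  decode (encode c ++ flatten (map enc_num ns) ++ nseq n 1)
  = if (ns == [::]) && (n == 0) && Defs.proper c then Some c else None.
Proof.
move=> Hns; rewrite /decode encode_quint catA -flatten_cat -map_cat parse_enc.
by case: (n == 0); rewrite ?andbF //= group5_quint //; case: (ns).
Qed.

(** Any bit string splits into complete tuples, fewer than five further fields and pending ones, so
    decoder and validation need only be compared on strings of this form. *)
Lemma bits_decomposition w : exists c ns n, size ns < 5 /\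
  map sym w = encode c ++ flatten (map enc_num ns) ++ nseq n 1.
Proof.
have [l [n ->]] : exists l n, map sym w = flatten (map enc_num l) ++ nseq n 1.
  elim: w => [|b w [l [n E]]]; first by exists [::], 0.
  rewrite /= E; case: b => /=; last by exists (0 :: l), n.
  by case: l {E} => [|a l]; [exists [::], n.+1 | exists (a.+1 :: l), n].
have [c [ns [Hns ->]]] : exists c ns, size ns < 5 /\ l = flatten (map quint c) ++ ns.
  have [m] := ubnP (size l); elim: m l => // m IH l lt_m.
  case: l lt_m => [|a [|q [|q' [|b [|d l]]]]] lt_m; try by eexists [::], _; split; last reflexivity.
  have [|c [ns [Hns ->]]] := IH l; first exact: leq_trans (leq_addl 4 _) (ltnSE lt_m).
  by exists ((a, q, q', b, d) :: c), ns.
by exists c, ns, n; rewrite map_cat flatten_cat -encode_quint catA.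
Qed.

Lemma parse_is_bit s acc l : parse_nums s acc = Some l -> all is_bit s.
Proof.
elim: s acc l => [|[|[|[|a]]] s IH] acc l //=; first exact: IH.
by case E: (parse_nums s 0) => [l'|] //= _; apply: IH E.
Qed.

Lemma decode_is_bit s d : decode s = Some d -> all is_bit s.
Proof. by rewrite /decode; case E: parse_nums => [l|] //= _; apply: parse_is_bit E. Qed.

Lemma decode_encode s d : decode s = Some d -> s = encode d /\ Defs.proper d.
Proof.
move=> Ed; have := symK (decode_is_bit Ed).
have [c [ns [n [Hns ->]]]] := bits_decomposition (bits s).
move=> Es; move: Ed; rewrite -Es decode_enc //; case: ifP => // /andP[/andP[/eqP-> /eqP->] pc] [<-].
by rewrite /= cats0.
Qed.

Lemma foldl_flag T (p : pred T) D l :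
  foldl (fun D t => if p t then D else true :: D) D l = u (count (predC p) l) ++ D.
Proof.
elim: l D => //= t l IH D; rewrite IH; case: (p t) => //=.
by elim: (count _ _) => //= n ->.
Qed.

Lemma uniq_count (T : eqType) (s : seq T) : uniq s = all (fun a => count_mem a s <= 1) s.
Proof.
apply/idP/allP => [us a _|H]; first by rewrite count_uniq_mem // leq_b1.
apply: count_mem_uniq => a; case: (boolP (a \in s)) => [a_s|/count_memPn //].
by apply/eqP; rewrite eqn_leq H // -has_count has_pred1.
Qed.

Lemma proper_counts l : Defs.proper l =
  (count (predC (fun t : transition => t.2 <= 1)) l == 0)
  && (count (predC (fun t => count (fun t' => tkey t' == tkey t) l <= 1)) l == 0).
Proof.
rewrite !eqn0Ngt -!has_count !has_predC !negbK; congr (_ && _).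
  by apply: eq_all => -[[[[a q] q'] b] d].
by rewrite uniq_count all_map; apply: eq_all => t /=; rewrite count_map.
Qed.

(** The fields of an unfinished tuple stay unspecified, since the verdict at the end depends only on
    [rF] and [rN4]. *)
Lemma scan_rest P r k o ns n : size ns < 5 -> exists n0 n1 n2 n3,
  scan_bits P (fresh r k o) (bits (flatten (map enc_num ns)) ++ u n)
  = Store (drop (size ns) F0 :: n0 :: n1 :: n2 :: n3 :: u n :: r) k o.
Proof.
case: ns => [|n0 [|n1 [|n2 [|n3 [|? ?]]]]] // _;
  by rewrite /= /bits ?map_cat -!/(bits _) /= -?catA /scan_bits ?foldl_cat -!/(scan_bits _)
     /fresh ?scan_field scan_true cats0; do 4!eexists.
Qed.

(** An incomplete tuple or a bad direction raises the flag before the second scan; otherwise that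
    scan decides uniqueness of keys. On failure only the flag and the unchanged output matter, as a
    dead machine does nothing more. *)
Lemma den_validate H O Bad U Par E w k o :
  let s T := fresh (core T H [::] [::] O Bad [::] [::] [::] [::] [::] U Par E) k o in
  if decode (map sym w) is Some d then den validate (s w) = s w
  else dead (den validate (s w)) /\ out (den validate (s w)) = o.
Proof.
move=> s; have [c [ns [n [Hns Ew]]]] := bits_decomposition w.
rewrite Ew decode_enc //.
have Ew' : w = bits (encode c) ++ bits (flatten (map enc_num ns)) ++ u n.
  by rewrite -(bitsK w) Ew /bits !map_cat map_nseq.
pose mkc Dead := core w H [::] [::] O Bad Dead [::] [::] [::] [::] U Par E.
set nd := count (predC (fun t : transition => t.2 <= 1)) c.
have E1 : den (scan rY check_dir) (s w)
    = scan_bits check_dir (fresh (mkc (u nd)) k o) (bits (flatten (map enc_num ns)) ++ u n).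
  rewrite [LHS](_ : _ = scan_bits check_dir (fresh (mkc [::]) k o) w) //.
  rewrite [X in scan_bits _ _ X]Ew' /scan_bits foldl_cat -!/(scan_bits _).
  by rewrite den_check_dir foldl_flag cats0.
rewrite (den_seq (scan rY check_dir)) (den_seq check_end) E1.
set fin := IfNE rDead _ _.
have dead_end s1 : dead s1 -> den fin s1 = s1.
  by rewrite den_ifne /dead; case: (get s1 rDead).
pose cnt := count (predC (fun t => count (fun t' => tkey t' == tkey t) c <= 1)) c.
have E2 : w = bits (encode c) -> den fin (fresh (mkc [::]) k o) = fresh (mkc (u cnt)) k o.
  move=> Ew2; rewrite den_ifne [get _ _](_ : _ = [::]) //.
  rewrite [LHS](_ : _ = scan_bits check_key (fresh (mkc [::]) k o) w) //.
  rewrite [X in scan_bits _ _ X]Ew2 (@den_check_key w) //.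
  by rewrite foldl_flag cats0.
(* [fin] is made opaque to keep simplification from unfolding the second scan. *)
move: fin dead_end E2 => fin dead_end E2.
case: eqP => [n0|nn0].
  case: eqP => [m0|nm0]; last first.
    have [n0' [n1 [n2 [n3 ->]]]] := scan_rest check_dir (mkc (u nd)) k o n Hns.
    by rewrite n0 /=; case: n nm0 {Ew Ew' E1} => // m _; rewrite dead_end.
  have {}Ew' : w = bits (encode c) by rewrite Ew' n0 m0 cats0.
  rewrite n0 m0 [_ ++ u 0](_ : _ = [::]) //.
  rewrite [den check_end _](_ : _ = fresh (mkc (u nd)) k o) // proper_counts -/nd -/cnt.
  case: nd {E1} => [|nd] /=; last by rewrite dead_end.
  by rewrite E2 //; case: cnt {E2} => [|cnt] /=.
have [n0' [n1 [n2 [n3 ->]]]] := scan_rest check_dir (mkc (u nd)) k o n Hns.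
by case: ns nn0 Hns {Ew Ew' E1} => [|m1 [|m2 [|m3 [|m4 [|? ?]]]]] //= _ _;
  rewrite dead_end.
Qed.

(** The fold keeps the last match and [lookup] takes the first; with unique keys they coincide. *)
Lemma lookup_match d a q z : uniq (map tkey d) ->
  foldl (match_fun a q) z d =
  if lookup d a q is Some (q', b, m) then (z.1.+1, (u q', u b, u m)) else z.
Proof.
rewrite /lookup; elim: d z => [|[[[[a' q1] q'] b] m] d IH] z //= /andP[nin ud].
case: eqP => [E|_]; last exact: IH.
rewrite IH // (_ : [seq t <- d | _] = [::]) //; apply/eqP.
rewrite -(negbK (_ == _)) -has_filter; apply: contra nin => /hasP[t td /eqP Et].
by rewrite E -Et map_f.
Qed.

(** * The phases of one round *)

Lemma den_parity T H q A O Bad k o :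
  den parity (fresh (core T H (u q) A O Bad [::] [::] [::] [::] [::] [::] [::] [::]) k o)
  = fresh (core T H (u q) A O Bad [::] [::] [::] [::] [::] [::] (u (odd q)) [::]) k o.
Proof.
rewrite /parity; set tog := IfNE _ _ _.
pose st (b : bool) := fresh (core T H (u q) A O Bad [::] [::] [::] [::] [::] [::] (u b) [::]) k o.
have Etog b : den tog (st b) = st (~~ b) by case: b.
transitivity (foldl (fun s (b : bool) => if b then den tog s else den tog s)
                (st false) (u q)) => //.
rewrite -/(st (odd q)) -[odd q]addFb; move: tog Etog false => tog Etog.
by elim: (q) => [|n IH] b /=; rewrite ?addbF // Etog IH addNb addbN.
Qed.

Lemma den_read_tape w h Q O Bad Par k o :
  den read_tape (fresh (core w (u h) Q [::] O Bad [::] [::] [::] [::] [::] [::] Par [::]) k o)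
  = fresh (core w (u h) Q (u (nth 0 (map sym w) h)) O Bad
             [::] [::] [::] [::] [::] [::] Par [::]) k o.
Proof.
pose st y := fresh (core_Y w (u h) Q [::] O Bad [::] [::] [::] [::] [::] y [::] Par [::]) k o.
have pops n y :
    foldl (fun s (b : bool) => if b then den (Pop rY) s else den (Pop rY) s) (st y) (u n)
    = st (drop n y).
  elim: n y => [|n IH] y; first by rewrite drop0.
  by rewrite /= [X in foldl _ X](_ : _ = st (behead y)) // IH; case: y => // ? ?; rewrite drop_nil.
rewrite /read_tape (den_seq (rY <~ rT)) (den_seq (rU <~ rH)) (den_seq (Loop rU _ _)).
rewrite [den (Loop _ _ _) _](_ : _ = st (drop h w)); last by rewrite -pops.
have -> : nth 0 (map sym w) h = if drop h w is b :: _ then sym b else 0.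
  by elim: w {st pops} h => [|b w IH] [|h] //=; rewrite IH.
by case: (drop h w) => [|[] y].
Qed.

(* [Bad] is nonempty once a symbol other than 1 and 2 has been written, after
   which the output tape can never become a code; [O] is then irrelevant. *)
Definition tape_rep (O Bad : seq bool) (ot : seq nat) : Prop :=
  if Bad is [::] then ot = map sym (rev O) else ~~ all is_bit ot.

Lemma den_move_write T h q a O Bad q' b m ot k o : tape_rep O Bad ot ->
  exists O' Bad', tape_rep O' Bad' (emit ot b) /\
  den move_heads
    (fresh (core T (u h) q a O Bad [::] (u 1) q' (u b) (u m) [::] (u true) [::]) k o)
  = fresh (core T (u (if m == 0 then h.-1 else h.+1)) q' [::] O' Bad' [::] [::] [::] [::] [::]
             [::] [::] [::]) k o.
Proof.
rewrite /tape_rep => Hrep.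
exists (if b == 1 then true :: O else if b == 2 then false :: O else O).
exists (if b <= 2 then Bad else true :: Bad); split; last first.
  by case: m => [|m]; case: h => [|h]; case: b => [|[|[|b]]].
case: b => [|[|[|b]]] //=; rewrite /emit /=.
- case: Bad Hrep => [->|? ? /negPf nb]; first by rewrite rev_cons map_rcons.
  by rewrite all_rcons nb andbF.
- case: Bad Hrep => [->|? ? /negPf nb]; first by rewrite rev_cons map_rcons.
  by rewrite all_rcons nb andbF.
- by rewrite all_rcons.
Qed.

Lemma den_move_read T h q a O Bad q' b m k o :
  den move_heads
    (fresh (core T h q a O Bad [::] (u 1) q' b m [::] (u false) [::]) k o)
  = fresh (core T h q' [::] O Bad [::] [::] [::] [::] [::] [::] [::] b) k o.
Proof. by []. Qed.

Lemma den_stay T h q' O Bad E k o : q' != 1 ->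
  let s := fresh (core T h (u q') [::] O Bad [::] [::] [::] [::] [::] [::] [::] E) k o in
  den change_state s = s.
Proof.
move=> Hq s; rewrite /change_state (den_seq (rU <~ rQ)) (den_seq (Pop rU)) den_ifne.
by case: q' Hq @s => [|[|q']].
Qed.

Lemma den_split T h O Bad E k o ot : tape_rep O Bad ot ->
  let s := fresh (core T h (u 1) [::] O Bad [::] [::] [::] [::] [::] [::] [::] E) k o in
  if decode ot is Some d then
    den change_state s =
    fresh (core (bits ot) [::] [::] [::] [::] [::] [::] [::] [::] [::] [::] [::] [::] E) k o
  else dead (den change_state s) /\ out (den change_state s) = o.
Proof.
move=> Hrep s; rewrite /change_state (den_seq (rU <~ rQ)) (den_seq (Pop rU)) den_ifne.
rewrite [get _ _](_ : _ = u 1) // den_ifne [get _ _](_ : _ = [::]) //.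
rewrite [den (Pop rU) _](_ : _ = s) // /split den_ifne [get _ _](_ : _ = Bad) //.
move: Hrep; rewrite /tape_rep; case EB: Bad => [|c Bad'].
  move=> Eot; have := den_validate [::] [::] [::] [::] [::] E (rev O) k o.
  lazy beta zeta; rewrite -Eot (den_seq (Clear rH)) (den_seq (Clear rQ)) (den_seq (Clear rT))
    (den_seq (Loop rO _ _)).
  rewrite [den (Loop _ _ _) _](_ : _ =
    fresh (core (rev O) [::] [::] [::] [::] [::] [::] [::] [::] [::] [::] [::] [::] E) k o).
    by rewrite Eot bitsK.
  pose st t := fresh (core t [::] [::] [::] [::] [::] [::] [::] [::] [::] [::] [::] [::] E) k o.
  have pushes l t : foldl (fun s (b : bool) =>
      if b then den (Push rT true) s else den (Push rT false) s) (st t) l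
    = st (catrev l t).
    elim: l t => //= c l IH t; rewrite [X in foldl _ X](_ : _ = st (c :: t)) ?IH //.
    by case: c.
  by rewrite -[RHS](pushes O [::]) /s EB.
(* A tape holding a symbol other than 1 and 2 has no decoding, so only failure is possible. *)
move=> nbit; case Ed: (decode ot) => [d|]; last by rewrite /s EB.
by rewrite (decode_is_bit Ed) in nbit.
Qed.

Lemma den_flush T h q O Bad b k l :
  den flush (fresh (core T h q [::] O Bad [::] [::] [::] [::] [::] [::] [::] (u b)) k (enc_out l))
  = fresh (core T h q [::] O Bad [::] [::] [::] [::] [::] [::] [::] [::]) k (enc_out (emit l b)).
Proof.
rewrite /flush den_ifne [get _ _](_ : _ = [::]) // den_ifne [get _ _](_ : _ = u b) //.
case: b => [|b] //; rewrite (den_seq (Loop _ _ _)).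
pose st o := fresh (core T h q [::] O Bad [::] [::] [::] [::] [::] [::] [::] [::]) k o.
rewrite [u b.+1]lock [den (Loop _ _ _) _](_ : _ = foldl (fun s (b : bool) =>
  if b then den (Out _ true) s else den (Out _ true) s) (st (enc_out l)) (u b.+1));
  last by rewrite -lock.
have outs n o : foldl (fun s (b : bool) => if b then den (Out _ true) s else den (Out _ true) s)
    (st o) (u n) = st (o ++ u n).
  elim: n o => [|n IH] o; first by rewrite cats0.
  by rewrite /= [X in foldl _ X](_ : _ = st (rcons o true)) // IH cat_rcons.
rewrite outs -lock [LHS](_ : _ = st (rcons (enc_out l ++ u b.+1) false)) //.
suff -> : rcons (enc_out l ++ u b.+1) false = enc_out (emit l b.+1) by [].
by rewrite /emit /= /enc_out map_rcons flatten_rcons rcons_cat.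
Qed.


(** * The simulation invariant *)

Definition ready c O Bad := fresh (core (bits (l_tape c)) (u (l_head c)) (u (l_state c)) [::] O Bad
  [::] [::] [::] [::] [::] [::] [::] [::]) (l_inpos c) (enc_out (l_out c)).

Definition rep (c : lconf) (s : store) : Prop :=
  decode (l_tape c) = Some (l_delta c) /\
  exists O Bad, tape_rep O Bad (l_otape c) /\ s = ready c O Bad.

Definition rep_step (c : lconf) (r : option lconf) (s : store) : Prop :=
  if r is Some c' then rep c' s else dead s /\ out s = enc_out (l_out c).

(** Serves both modes: [b] is the pending output symbol, taken to be 0 in reproducing mode, where
    [emit] changes nothing. *)
Lemma den_change c q' h O Bad ot k b : decode (l_tape c) = Some (l_delta c) ->
  tape_rep O Bad ot ->
  rep_step c (continue_or_split c q' h ot k (emit (l_out c) b))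
    (den (change_state ;; flush)
       (fresh (core (bits (l_tape c)) (u h) (u q') [::] O Bad [::] [::] [::] [::] [::] [::] [::]
          (u b)) k (enc_out (l_out c)))).
Proof.
move=> Ed Hrep; rewrite den_seq /continue_or_split; case: eqP => [->|/eqP Hq].
  have := den_split (bits (l_tape c)) (u h) (u b) k (enc_out (l_out c)) Hrep.
  lazy beta zeta; case Ed' : (decode ot) => [d|]; last first.
    rewrite /rep_step /flush den_ifne; move: (den _ _) => s.
    by rewrite /dead; case E: (get s rDead) => [|e l] [] //; rewrite E.
  by move=> ->; rewrite den_flush; split=> //; exists [::], [::].
by rewrite den_stay // den_flush; split=> //; exists O, Bad.
Qed.

Lemma den_lookup c a k (par : bool) h q O Bad E o s :
  decode (l_tape c) = Some (l_delta c) ->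
  s = fresh (core (bits (l_tape c)) (u h) (u q) (u a) O Bad
               [::] [::] [::] [::] [::] [::] (u par) E) k o ->
  den (scan rX match_entry ;; IfNE rFound act kill) s =
  if lookup (l_delta c) a q is Some (q', b, m) then
    den act (fresh (core (bits (l_tape c)) (u h) (u q) (u a) O Bad [::] (u 1) (u q') (u b) (u m)
                      [::] (u par) E) k o)
  else upd rDead [:: true] s.
Proof.
move=> Ed ->; have [Et] := decode_encode Ed; case/andP=> _ ud.
rewrite (den_seq (scan rX match_entry)) den_ifne.
have := @den_match (bits (l_tape c)) (u h) (u q) (u a) O Bad [::] [::] (u par) E a q k o
  (l_delta c) erefl erefl (congr1 bits Et) (0, ([::], [::], [::])).
rewrite lookup_match //; lazy beta zeta.
case: (lookup _ _ _) => [[[q' b] m]|] ->.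
  by rewrite [get _ _](_ : _ = u 1).
by rewrite [get _ _](_ : _ = [::]).
Qed.

Lemma den_body c s : rep c s -> rep_step c (lstep x c) (den body s).
Proof.
move=> [Ed [O [Bad [Hrep ->]]]].
rewrite /body den_ifne [get _ _](_ : _ = [::]) // /run.
rewrite (den_seq parity) (den_seq observe) /ready den_parity /lstep /in_R.
case: (odd (l_state c)).
(* [read_tape] is generalised so that simplification selects the branch without unfolding it. *)
- have Eobs s1 : get s1 rPar = [:: true] -> den observe s1 = den read_tape s1.
    by rewrite /observe; move: read_tape => r /= ->.
  rewrite Eobs //.
  rewrite den_read_tape symK ?(decode_is_bit Ed) //.
  rewrite (den_lookup (par := true) Ed erefl).
  case: (lookup _ _ _) => [[[q' b] m]|] //.
  rewrite /act (den_seq move_heads).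
  have [O' [Bad' [Hrep' ->]]] := den_move_write (bits (l_tape c)) (l_head c)
     (u (l_state c)) (u (nth 0 (l_tape c) (l_head c))) (u q') b m
     (l_inpos c) (enc_out (l_out c)) Hrep.
  exact: (@den_change c q' _ O' Bad' _ (l_inpos c) 0 Ed Hrep').
- have Eobs s1 : get s1 rPar = [::] -> den observe s1 = den (ReadNum rA) s1.
    by rewrite /observe; move: read_tape => r /= ->.
  rewrite Eobs // [den _ (fresh _ _ _)](_ : _ = fresh (core (bits (l_tape c)) (u (l_head c))
    (u (l_state c)) (u (x (l_inpos c)) ++ [::]) O Bad [::] [::] [::] [::] [::] [::] (u false) [::])
    (l_inpos c).+1 (enc_out (l_out c))) // cats0.
  rewrite (den_lookup (par := false) Ed erefl).
  case: (lookup _ _ _) => [[[q' b] m]|] //.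
  by rewrite /act (den_seq move_heads) den_move_read; apply: den_change.
Qed.

Lemma den_load t1 : is_code t1 ->
  rep (lineage_init t1) (den (load (bits t1)) (Store [::] 0 [::])).
Proof.
rewrite /is_code /lineage_init; case Ed: (decode t1) => [d|] // _.
split=> //; exists [::], [::]; split=> //.
rewrite /load (den_seq (Clear rE)) (den_seq clean).
pose st t := fresh (core t [::] [::] [::] [::] [::] [::] [::] [::] [::] [::] [::] [::] [::]) 0 [::].
rewrite [den clean _](_ : _ = st [::]) //.
suff H t : den (foldr (fun b c => c ;; Push rT b) skip t) (st [::]) = st t by rewrite H.
by elim: t => //= b t ->.
Qed.

(** The second alternative covers a stopped lineage: [iter_step] stays at the last configuration,
    and [body] fixes a flagged store. *)
Definition simulates c s :=
  rep c s \/ [/\ lstep x c = None, dead s & out s = enc_out (l_out c)].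

Lemma simulates_out c s : simulates c s -> out s = enc_out (l_out c).
Proof. by case=> [[_ [O [Bad [_ ->]]]]|[]]. Qed.

Lemma simulates_body c s : simulates c s -> simulates (odflt c (lstep x c)) (den body s).
Proof.
case=> [H|[E ds os]].
  have := den_body H; rewrite /rep_step; case E: (lstep x c) => [c'|]; first by left.
  by case=> ds os; right.
rewrite E; right; suff -> : den body s = s by [].
by rewrite /body den_ifne; move: ds; rewrite /dead; case: (get s rDead).
Qed.

End Interpreter.

(** * Assembling the machine *)

Definition blank_cell : cell 22 := (false, [ffun=> None]).

(** Blank cells are unmarked, so cell 0 must be marked before any sweep [home], which stops only at
    the mark. *)
Definition mark_origin : raw (cell 22) := Act (fun g : cell 22 => ((true, g.2), MStay, None)).

Lemma exec_mark_origin x (s : nat -> bool) :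
  exec s mark_origin (Data (fun _ => blank_cell) 0 0 [::]) (@at_head 22 x 0 (Store [::] 0 [::])).
Proof.
have -> : @at_head 22 x 0 (Store [::] 0 [::])
  = perform (true, blank_cell.2, MStay, None) false (Data (fun _ => blank_cell) 0 0 [::]).
  congr Data; apply: functional_extensionality => p.
  by case: p => [|p]; congr (_, _); apply/ffunP => i; rewrite !ffunE /rows /get nth_nil.
exact: exec_act.
Qed.

Theorem theorem1 (t1 : seq nat) (Ht1 : is_code t1) :
  exists M : itm, forall x : nat -> nat, (forall k, 0 < x k) ->
    same_stream (fun n => enc_out (lineage_out t1 x n))
                (fun m => itm_out M (enc_stream x) m).
Proof.
pose init := Sequ mark_origin (compile (load (bits t1))).
exists (machine blank_cell (forever init (compile body))) => x _.
pose S n := iter n (den x body) (den x (load (bits t1)) (Store [::] 0 [::])).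
have outS n : out (S n) = enc_out (lineage_out t1 x n).
  apply: (@simulates_out x); elim: n => [|n IH]; first by left; apply: den_load.
  by rewrite iter_stepSr; apply: simulates_body.
have sync : forall n, exists2 m, n <= m &
    itm_out (machine blank_cell (forever init (compile body))) (enc_stream x) m
    = out (S n).
  apply: (@forever_steps _ _ _ _ _ _ (fun n => @at_head 22 x 0 (S n)) erefl).
    apply: exec_seq (exec_mark_origin x _) _.
    exact: compile_correct (ok_load _).
  by move=> n; apply: compile_correct ok_body.
split=> [n|m].
  by have [m _ E] := sync n; exists m; rewrite E outS prefix_refl.
(* The store [S m] is reached no earlier than time [m], so its output extends the output at time
   [m]. *)
by have [m' le_m E] := sync m; exists m; rewrite -outS -E itm_out_prefix.
Qed.
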